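(* Let $x \in \mathbb{R}^p$ be a random vector that follows the block-independent model with blocks of sizes $d_j$, and let $K = \max_{1\le i \le p} \mathbb{E}x_i^4$ be the largest fourth moment of the entries of $x$. Then for every deterministic matrix $A \in \mathbb{R}^{p\times p}$, $$\operatorname{Var}(x^\mathsf{T} A x) \le \|A\|^2\Big(K\sum_j d_j^2 + 2p\Big),$$ where $\|A\|$ is the spectral (operator) norm.
   Context: Block-independent model: a random vector $x \in \mathbb{R}^p$ follows the block-independent model with blocks of sizes $d_j$ if $\mathbb{E}x = 0$, $\mathbb{E} x x^\mathsf{T} = I_p$ (isotropy), and the coordinate index set $[p]$ is partitioned into disjoint blocks $I_1, I_2,\dots$ with $|I_j| = d_j$ such that the sub-vectors $(x_i)_{i \in I_j}$, $j=1,2,\dots$, are mutually independent (entries within the same block may be dependent). *)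

(* Defs.v *)
From HB Require Import structures.
From mathcomp Require Import all_boot all_order all_algebra.
From mathcomp Require Import all_classical all_reals all_analysis.
Set Implicit Arguments. Unset Strict Implicit. Unset Printing Implicit Defensive.
Import Order.TTheory GRing.Theory Num.Theory.
Local Open Scope classical_set_scope.
Local Open Scope ring_scope.

Definition vnorm2 (R : realType) (p : nat) (v : 'I_p -> R) : R :=
  Num.sqrt (\sum_(i < p) v i ^+ 2).

Definition spec_norm (R : realType) (p : nat) (A : 'M[R]_p) : R :=
  sup [set vnorm2 (fun i => \sum_(j < p) A i j * v j) | v in
       [set v : 'I_p -> R | vnorm2 v <= 1]].

Definition quad_form (T : Type) (R : realType) (p : nat) (A : 'M[R]_p)
  (x : 'I_p -> T -> R) : T -> R :=
  fun w => \sum_(i < p) \sum_(j < p) x i w * A i j * x j w.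

Definition block_sigma d (T : measurableType d) (R : realType) (p m : nat)
  (blk : 'I_p -> 'I_m) (x : 'I_p -> T -> R) (j : 'I_m) : set_system T :=
  <<s [set E | exists i, blk i = j /\
        exists B : set R, measurable B /\ E = x i @^-1` B] >>.

Definition blocks_independent d (T : measurableType d) (R : realType)
  (P : probability T R) (p m : nat) (blk : 'I_p -> 'I_m)
  (x : 'I_p -> T -> R) : Prop :=
  forall (E : 'I_m -> set T), (forall j, block_sigma blk x j (E j)) ->
  forall J : {set 'I_m},
    P (\bigcap_(j in [set j | j \in J]) E j) = (\prod_(j in J) P (E j))%E.

Definition block_independent_model d (T : measurableType d) (R : realType)
  (P : probability T R) (p m : nat) (blk : 'I_p -> 'I_m)
  (x : 'I_p -> T -> R) : Prop :=
  [/\ forall i, ('E_P[x i] = 0)%E,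
      forall i j, ('E_P[x i \* x j] = ((i == j)%:R)%:E)%E
    & blocks_independent P blk x].

(* Main.v *)
Require Import Defs.
From HB Require Import structures.
From mathcomp Require Import all_boot all_order all_algebra.
From mathcomp Require Import all_classical all_reals all_analysis.
From mathcomp Require Import measurable_realfun zify ring lra.
Set Implicit Arguments.
Unset Strict Implicit.
Import Order.TTheory GRing.Theory Num.Theory.
Local Open Scope classical_set_scope.
Local Open Scope ring_scope.

(* Write Q for the quadratic form and expand Var Q over pairs of index pairs:
   it is the sum of A_ij A_kl (E[x_i x_j x_k x_l] - [i = j][k = l]).
   Factorizing each fourth-order moment over the blocks, a term survives only if
   - i, j, k, l lie in one block a: these terms add up to the variance of the
     form x_a^T A_a x_a of that block, at most
     E[(x_a^T A_a x_a)^2] <= |A|^2 E[|x_a|^4] <= |A|^2 K d_a^2, or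
   - i, j are in different blocks and {k, l} = {i, j}: these add up to at most
     2 |A|_F^2 <= 2 p |A|^2.
   If K is infinite the bound is infinite unless A = 0 or p = 0. *)

(** * Products over independent sigma-algebras *)

Lemma measurable_fun_sub_sigma d (T : measurableType d) (R : realType)
    (G : set (set T)) (f : T -> R) : <<s G >> `<=` (@measurable d T) ->
  measurable_fun [set: g_sigma_algebraType G] (f : g_sigma_algebraType G -> R) ->
  measurable_fun [set: T] f.
Proof. by move=> sG mf _ B mB; apply: sG; exact: (mf measurableT B mB). Qed.

Section ge0_integral_indepM.
Import HBNNSimple.

(** Here [c] is the integral of [g] (take [E = setT]). The last hypothesis is the claim for
    indicators; linearity extends it to simple functions and monotone convergence to [f]. *)
Lemma ge0_integral_indepM d (T : measurableType d) (R : realType)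
    (P : probability T R) (G : set (set T)) (f g : T -> R) (c : R) :
  <<s G >> `<=` (@measurable d T) ->
  measurable_fun [set: g_sigma_algebraType G] (f : g_sigma_algebraType G -> R) ->
  (forall w, 0 <= f w) -> measurable_fun setT g -> (forall w, 0 <= g w) ->
  (forall E, <<s G >> E -> \int[P]_w (\1_E w * g w)%:E = P E * c%:E)%E ->
  (\int[P]_w (f w * g w)%:E = \int[P]_w (f w)%:E * c%:E)%E.
Proof.
move=> sG mf f0 mg g0 indep.
have mEf : measurable_fun [set: g_sigma_algebraType G]
    ((EFin \o f) : g_sigma_algebraType G -> \bar R).
  exact/measurable_EFinP.
(* Approximating over the generated sigma-algebra, not over that of [T], puts the level sets of
   [h n] in [<<s G>>], where [indep] applies. *)
pose h := nnsfun_approx measurableT mEf.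
pose phi (n : nat) : T -> R := h n.
have mphi n : measurable_fun setT (phi n).
  by apply: measurable_fun_sub_sigma sG _; exact: (measurable_funPT (h n)).
have phi0 n w : 0 <= phi n w by exact: fun_ge0.
have ndphi w : nondecreasing_seq (fun n => phi n w).
  by move=> m n mn; have /lefP := nd_nnsfun_approx measurableT mEf mn; exact.
have cphi w : (EFin \o phi^~ w) @ \oo --> (f w)%:E.
  by apply: (@cvg_nnsfun_approx _ _ _ _ measurableT _ mEf) => // t _; rewrite lee_fin.
have phiE n : (\int[P]_w (phi n w * g w)%:E = \int[P]_w (phi n w)%:E * c%:E)%E.
  have mpre y : <<s G >> (phi n @^-1` [set y]).
    have /(_ measurableT [set y] (measurable_set1 y)) :
      measurable_fun [set: g_sigma_algebraType G]
        (phi n : g_sigma_algebraType G -> R) by exact: (measurable_funPT (h n)).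
    by rewrite setTI.
  have rphi0 y : y \in range (phi n) -> 0 <= y by move=> /set_mem[w _ <-].
  pose s := finmap.enum_fset (fset_set (range (phi n))).
  have frange : finite_set (range (phi n)).
    exact: (@fimfunP _ _ (h n)).
  have s0 y : y \in s -> 0 <= y.
    by move=> ys; apply: rphi0; rewrite -in_fset_set.
  (* Values of [phi n] are nonnegative, so [Num.max y 0] changes nothing on [s], but it makes every
     summand nonnegative for arbitrary [y], as [ge0_integral_sum] requires. *)
  have phiS w : phi n w = \sum_(y <- s) Num.max y 0 * \1_(phi n @^-1` [set y]) w.
    rewrite [LHS](fimfunE (h n)) fsbig_finite//=.
    rewrite big_seq [RHS]big_seq; apply: eq_bigr => y ys.
    by congr (_ * _); apply/esym/max_idPl; exact: s0.
  under eq_integral do rewrite phiS mulr_suml -sumEFin.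
  under [in RHS]eq_integral do rewrite phiS -sumEFin.
  have m0 (y : R) : 0 <= Num.max y 0 by rewrite le_max lexx orbT.
  have mind y : measurable_fun setT (\1_(phi n @^-1` [set y]) : T -> R).
    exact/measurable_indic/sG.
  rewrite !ge0_integral_sum//=.
  - rewrite ge0_sume_distrl; last first.
      by move=> y _; apply: integral_ge0 => w _; rewrite lee_fin mulr_ge0.
    apply: eq_bigr => y _.
    under eq_integral do rewrite -mulrA EFinM.
    under [in RHS]eq_integral do rewrite EFinM.
    rewrite !ge0_integralZl//=.
    + by rewrite indep// integral_indic ?setIT ?muleA//; exact: sG.
    + exact/measurable_EFinP.
    + by rewrite lee_fin.
    + by apply/measurable_EFinP/measurable_funM.
    + by move=> w _; rewrite lee_fin mulr_ge0.
    + by rewrite lee_fin.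
  - by move=> y; apply/measurable_EFinP/measurable_funM.
  - by move=> y w _; rewrite lee_fin mulr_ge0.
  - by move=> y; apply/measurable_EFinP/measurable_funM => //; apply: measurable_funM.
  - by move=> y w _; rewrite lee_fin !mulr_ge0.
have lim1 : (\int[P]_w (phi n w * g w)%:E @[n --> \oo] --> \int[P]_w (f w * g w)%:E)%E.
  rewrite (_ : (\int[P]_w (f w * g w)%:E =
      \int[P]_w limn (fun n => (phi n w * g w)%:E))%E); last first.
    apply: eq_integral => w _; apply/esym/cvg_lim => //.
    under eq_fun do rewrite EFinM. rewrite EFinM.
    by apply: cvgeZr => //; exact: cphi.
  apply: cvg_monotone_convergence => //.
  - by move=> n; apply/measurable_EFinP/measurable_funM.
  - by move=> n w _; rewrite lee_fin mulr_ge0.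
  - by move=> w _ m n mn; rewrite lee_fin ler_wpM2r//; exact: ndphi.
have lim2 : (\int[P]_w (phi n w)%:E @[n --> \oo] --> \int[P]_w (f w)%:E)%E.
  rewrite (_ : (\int[P]_w (f w)%:E =
      \int[P]_w limn (fun n => (phi n w)%:E))%E); last first.
    by apply: eq_integral => w _; apply/esym/cvg_lim => //; exact: cphi.
  apply: cvg_monotone_convergence => //.
  - by move=> n; apply/measurable_EFinP.
  - by move=> n w _; rewrite lee_fin.
  - by move=> w _ m n mn; rewrite lee_fin; exact: ndphi.
have lim3 : (\int[P]_w (phi n w * g w)%:E @[n --> \oo] -->
    \int[P]_w (f w)%:E * c%:E)%E.
  under eq_fun do rewrite phiE.
  exact: cvgeZr.
by apply: (cvg_unique _ lim1 lim3).
Qed.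

End ge0_integral_indepM.

Lemma EFin_Rintegral d (T : measurableType d) (R : realType)
    (P : probability T R) (f : T -> R) : P.-integrable setT (EFin \o f) ->
  (\int[P]_w f w)%:E = (\int[P]_w (f w)%:E)%E.
Proof. by move=> intf; rewrite /Rintegral fineK//; exact: integrable_fin_num. Qed.

Lemma measurable_bigprod d (T : measurableType d) (R : realType) (I : finType)
    (Q : pred I) (f : I -> T -> R) :
  (forall i, measurable_fun setT (f i)) ->
  measurable_fun setT (fun w => \prod_(i | Q i) f i w).
Proof.
move=> mf; under eq_fun do rewrite -big_enum/=.
by apply: measurable_prod => i _; exact: mf.
Qed.

Lemma bigprod_replace (R : comPzRingType) (I : finType) (T : Type) (j0 : I)
    (h : T -> R) (f : I -> T -> R) w :
  \prod_j (if j == j0 then h else f j) w = h w * \prod_(j | j != j0) f j w.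
Proof.
rewrite (bigD1 j0)//= eqxx; congr (_ * _).
by apply: eq_bigr => j /negbTE ->.
Qed.

Lemma prod_indic (R : comPzRingType) (I : finType) (T : Type) (E : I -> set T) w :
  \prod_j \1_(E j) w = \1_(\bigcap_j E j) w :> R.
Proof.
rewrite indicE; have [/set_mem Ew|/negP Ew] := boolP (w \in _).
  by rewrite big1// => j _; rewrite indicE mem_set//; exact: Ew.
have [j Ejw] : exists j, ~ E j w.
  by apply/existsNP => H; apply: Ew; apply/mem_set => j _.
by rewrite (bigD1 j)//= indicE memNset// mul0r.
Qed.

Definition sigma_measurable d (T : measurableType d) (R : realType)
    (G : set (set T)) (f : T -> R) :=
  measurable_fun [set: g_sigma_algebraType G] (f : g_sigma_algebraType G -> R).

(** Intersecting over the whole index set suffices: a subfamily is recovered by putting [setT] at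
    the other indices. *)
Definition sigma_independent d (T : measurableType d) (R : realType)
    (P : probability T R) (I : finType) (G : I -> set (set T)) :=
  forall E : I -> set T, (forall j, <<s G j >> (E j)) ->
    P (\bigcap_j E j) = (\prod_j P (E j))%E.

Lemma sigma_measurable_indic d (T : measurableType d) (R : realType)
    (G : set (set T)) (E : set T) : <<s G >> E ->
  @sigma_measurable _ _ R G (\1_E).
Proof. by move=> GE; exact: (@measurable_indic _ (g_sigma_algebraType G)). Qed.

(* Only the first [n] functions need not be indicators: induction on [n]
   replaces one indicator at a time, by [ge0_integral_indepM]. *)
Lemma ge0_integral_prod_indep d (T : measurableType d) (R : realType)
    (P : probability T R) (m : nat) (G : 'I_m -> set (set T)) :
  (forall j, <<s G j >> `<=` (@measurable d T)) -> sigma_independent P G ->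
  forall (n : nat) (f : 'I_m -> T -> R),
  (forall j, sigma_measurable (G j) (f j)) -> (forall j w, 0 <= f j w) ->
  (forall j, P.-integrable setT (EFin \o f j)) ->
  (forall j : 'I_m, (n <= j)%N -> exists2 E, <<s G j >> E & f j = \1_E) ->
  (\int[P]_w (\prod_j f j w)%:E = (\prod_j \int[P]_w f j w)%:E)%E.
Proof.
move=> sG indep; elim=> [|n IH] f mf f0 intf find.
  have /choice[E fE] : forall j, exists E, <<s G j >> E /\ f j = \1_E.
    by move=> j; have [E ? ?] := find j (leq0n j); exists E.
  have mE j : measurable (E j) by apply: (sG j); exact: (fE j).1.
  under eq_integral do under eq_bigr do rewrite (fE _).2.
  under eq_integral do rewrite prod_indic.
  rewrite integral_indic ?setIT//; last first.
    by apply: fin_bigcap_measurable => //; exact: finite_finset.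
  rewrite [LHS](indep E); last by move=> j; exact: (fE j).1.
  rewrite -prodEFin; apply: eq_bigr => j _.
  by rewrite EFin_Rintegral// (fE j).2 integral_indic ?setIT.
(* Past [m] no index is left to constrain, so the induction hypothesis applies directly. *)
have [nm|mn] := ltnP n m; last first.
  by apply: IH => // j; have := ltn_ord j; lia.
pose j0 := Ordinal nm.
have find' E (j : 'I_m) : (n <= j)%N -> <<s G j0 >> E ->
    exists2 E', <<s G j >> E' & (if j == j0 then \1_E else f j) = \1_E'.
  move=> nj GE; have [->|jj0] := eqVneq j j0; first by exists E.
  by apply: find; rewrite ltn_neqAle nj andbT; apply: contraNN jj0 => /eqP nj';
    apply/eqP/val_inj.
have mrest : measurable_fun setT (fun w => \prod_(j | j != j0) f j w).
  by apply: measurable_bigprod => j; exact: (measurable_fun_sub_sigma (@sG j) (mf j)).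
under eq_integral do rewrite (bigD1 j0)//=.
rewrite (bigD1 j0)//= EFinM EFin_Rintegral//.
apply: (ge0_integral_indepM (@sG j0) (mf j0)) => //.
  by move=> w; apply: prodr_ge0 => j _; exact: f0.
(* With [\1_E] in place of [f j0], the induction hypothesis factorizes the product; [c] is the
   product of the other integrals. *)
move=> E GE; have mE := sG _ _ GE.
under eq_integral do rewrite -(bigprod_replace j0 \1_E).
rewrite IH.
- rewrite (bigD1 j0)//= eqxx EFinM EFin_Rintegral; last first.
    by apply: integrable_indic => //; rewrite ltey_eq fin_num_measure.
  rewrite integral_indic ?setIT//; congr (_ * _%:E)%E.
  by apply: eq_bigr => j /negbTE ->.
- move=> j; case: eqP => [->|_]; last exact: mf.
  exact: sigma_measurable_indic.
- by move=> j w; case: ifP.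
- move=> j; case: ifP => // _.
  by apply: integrable_indic => //; rewrite ltey_eq fin_num_measure.
- by move=> j nj; exact: find'.
Qed.

(** The nonnegative case, applied to the absolute values, shows that the integral of the absolute
    product is a finite product of reals. *)
Lemma integrable_prod_indep d (T : measurableType d) (R : realType)
    (P : probability T R) (m : nat) (G : 'I_m -> set (set T))
    (f : 'I_m -> T -> R) :
  (forall j, <<s G j >> `<=` (@measurable d T)) -> sigma_independent P G ->
  (forall j, sigma_measurable (G j) (f j)) ->
  (forall j, P.-integrable setT (EFin \o f j)) ->
  P.-integrable setT (EFin \o (fun w => \prod_j f j w)).
Proof.
move=> sG indep mf intf; apply/integrableP; split.
  apply/measurable_EFinP/measurable_bigprod => j.
  exact: (measurable_fun_sub_sigma (@sG j) (mf j)).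
under eq_integral do rewrite /= normr_prod.
(* Taking [n := m] leaves no factor that has to be an indicator. *)
rewrite (@ge0_integral_prod_indep _ _ _ P m G sG indep m
    (fun j w => `|f j w|)) ?ltry//.
- by move=> j; apply: measurableT_comp => //; exact: mf.
- by move=> j; exact: integrable_norm.
- by move=> j; rewrite leqNgt ltn_ord.
Qed.

(** Factors are split into positive and negative parts one at a time, using linearity in each
    factor. The induction is on [n], where only factors of index below [n] may change sign; the base
    case is the nonnegative one. *)
Lemma Rintegral_prod_indep d (T : measurableType d) (R : realType)
    (P : probability T R) (m : nat) (G : 'I_m -> set (set T))
    (f : 'I_m -> T -> R) :
  (forall j, <<s G j >> `<=` (@measurable d T)) -> sigma_independent P G ->
  (forall j, sigma_measurable (G j) (f j)) ->
  (forall j, P.-integrable setT (EFin \o f j)) ->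
  \int[P]_w (\prod_j f j w) = \prod_j \int[P]_w f j w.
Proof.
move=> sG indep mf intf.
suff H n : forall f : 'I_m -> T -> R,
    (forall j, sigma_measurable (G j) (f j)) ->
    (forall j, P.-integrable setT (EFin \o f j)) ->
    (forall j : 'I_m, (n <= j)%N -> forall w, 0 <= f j w) ->
    \int[P]_w (\prod_j f j w) = \prod_j \int[P]_w f j w.
  by apply: (H m) => // j; rewrite leqNgt ltn_ord.
elim: n => {mf intf} [|n IH] {}f mf intf f0.
  apply: EFin_inj; rewrite EFin_Rintegral; last exact: integrable_prod_indep.
  rewrite (@ge0_integral_prod_indep _ _ _ P m G sG indep m)//.
  - by move=> j w; exact: f0.
  - by move=> j; rewrite leqNgt ltn_ord.
have [nm|mn] := ltnP n m; last first.
  by apply: IH => // j; have := ltn_ord j; lia.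
pose j0 := Ordinal nm.
pose r h j : T -> R := if j == j0 then h else f j.
have mr h : sigma_measurable (G j0) h ->
    forall j, sigma_measurable (G j) (r h j).
  by move=> mh j; rewrite /r; case: eqP => [->//|_]; exact: mf.
have ir h : P.-integrable setT (EFin \o h) ->
    forall j, P.-integrable setT (EFin \o r h j).
  by move=> ih j; rewrite /r; case: ifP.
have r0 h : (forall w, 0 <= h w) ->
    forall j : 'I_m, (n <= j)%N -> forall w, 0 <= r h j w.
  move=> h0 j nj; rewrite /r; have [_//|jj0] := eqVneq j j0.
  by apply: f0; rewrite ltn_neqAle nj andbT; apply: contraNN jj0 => /eqP nj';
    apply/eqP/val_inj.
have mP : sigma_measurable (G j0) (f j0)^\+ by apply: measurable_funrpos; exact: mf.
have mN : sigma_measurable (G j0) (f j0)^\- by apply: measurable_funrneg; exact: mf.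
have iP : P.-integrable setT (EFin \o (f j0)^\+) by exact: integrable_funrpos.
have iN : P.-integrable setT (EFin \o (f j0)^\-) by exact: integrable_funrneg.
have Ep := IH _ (mr _ mP) (ir _ iP) (r0 _ (funrpos_ge0 _)).
have En := IH _ (mr _ mN) (ir _ iN) (r0 _ (funrneg_ge0 _)).
have fE w : f j0 w = (f j0)^\+ w - (f j0)^\- w.
  by rewrite -{1}(funrposBneg (f j0)).
transitivity (\int[P]_w (\prod_j r (f j0)^\+ j w) - \int[P]_w (\prod_j r (f j0)^\- j w)).
  rewrite -RintegralB//.
  - apply: eq_Rintegral => w _.
    by rewrite /r !bigprod_replace -mulrBl -fE (bigD1 j0).
  - by apply: integrable_prod_indep sG indep _ _; [exact: mr|exact: ir].
  - by apply: integrable_prod_indep sG indep _ _; [exact: mr|exact: ir].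
rewrite Ep En (bigD1 j0)//= [X in _ - X](bigD1 j0)//= [RHS](bigD1 j0)//=.
have rE h : \prod_(j | j != j0) \int[P]_w r h j w = \prod_(j | j != j0) \int[P]_w f j w.
  by apply: eq_bigr => j /negbTE jj0; rewrite /r jj0.
rewrite !rE -mulrBl; congr (_ * _).
rewrite /r eqxx -RintegralB//; apply: eq_Rintegral => w _.
by rewrite -fE.
Qed.

(** * The spectral norm *)

Lemma sum_delta (R : pzRingType) (I : finType) (i : I) (F : I -> R) :
  \sum_j F j * (i == j)%:R = F i.
Proof.
rewrite (bigD1 i)//= eqxx mulr1 big1 ?addr0// => j.
by rewrite eq_sym => /negbTE ->; rewrite mulr0.
Qed.

Lemma sqr_sum (R : pzRingType) (I : finType) (Q : pred I) (F : I -> R) :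
  (\sum_(i | Q i) F i) ^+ 2 = \sum_(i | Q i) \sum_(j | Q j) F i * F j.
Proof.
by rewrite expr2 mulr_suml; apply: eq_bigr => i _; rewrite mulr_sumr.
Qed.

(** Lagrange's identity: twice the gap is the sum of the squares of [a i * b j - a j * b i]. *)
Lemma cauchy_schwarz_sum (R : realFieldType) (I : finType) (a b : I -> R) :
  (\sum_i a i * b i) ^+ 2 <= (\sum_i a i ^+ 2) * (\sum_i b i ^+ 2).
Proof.
have E1 : (\sum_i a i ^+ 2) * (\sum_i b i ^+ 2) =
    \sum_i \sum_j a i ^+ 2 * b j ^+ 2.
  by rewrite mulr_suml; apply: eq_bigr => i _; rewrite mulr_sumr.
have E2 : \sum_i \sum_j a i ^+ 2 * b j ^+ 2 = \sum_i \sum_j a j ^+ 2 * b i ^+ 2.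
  by rewrite exchange_big.
have : 0 <= \sum_i \sum_j (a i * b j - a j * b i) ^+ 2.
  by apply: sumr_ge0 => i _; apply: sumr_ge0 => j _; exact: sqr_ge0.
have -> : \sum_i \sum_j (a i * b j - a j * b i) ^+ 2 =
    \sum_i \sum_j a i ^+ 2 * b j ^+ 2 + \sum_i \sum_j a j ^+ 2 * b i ^+ 2
    - 2 * \sum_i \sum_j (a i * b i) * (a j * b j).
  rewrite mulr_sumr -big_split -sumrB/=; apply: eq_bigr => i _.
  rewrite mulr_sumr -big_split -sumrB/=; apply: eq_bigr => j _.
  by ring.
by rewrite -E2 -E1 -sqr_sum; lra.
Qed.

(** Cauchy-Schwarz against the indicator of [Q]. *)
Lemma sqr_sum_le_card (R : realFieldType) (I : finType) (Q : pred I) (a : I -> R) :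
  (\sum_(i | Q i) a i) ^+ 2 <= #|Q|%:R * \sum_(i | Q i) a i ^+ 2.
Proof.
have := cauchy_schwarz_sum (fun i => (Q i)%:R) (fun i => (Q i)%:R * a i).
rewrite [X in X ^+ 2 <= _](_ : _ = \sum_(i | Q i) a i); last first.
  rewrite [RHS]big_mkcond/=; apply: eq_bigr => i _.
  by case: (Q i); rewrite ?mul1r ?mul0r.
rewrite [X in _ <= X * _](_ : _ = #|Q|%:R); last first.
  rewrite -sum1_card natr_sum [RHS]big_mkcond/=; apply: eq_bigr => i _.
  by rewrite unfold_in; case: (Q i); rewrite ?expr1n ?expr0n.
rewrite [X in _ <= _ * X](_ : _ = \sum_(i | Q i) a i ^+ 2)//.
rewrite [RHS]big_mkcond/=; apply: eq_bigr => i _.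
by case: (Q i); rewrite ?mul1r ?mul0r ?expr0n.
Qed.

Lemma vnorm2_le (R : realType) (p : nat) (v : 'I_p -> R) (c : R) : 0 <= c ->
  (vnorm2 v <= c) = (\sum_i v i ^+ 2 <= c ^+ 2).
Proof.
move=> c0; have s0 : 0 <= \sum_i v i ^+ 2.
  by apply: sumr_ge0 => i _; exact: sqr_ge0.
rewrite /vnorm2 -(@ler_pXn2r _ 2)// ?nnegrE ?sqrtr_ge0//.
by rewrite sqr_sqrtr.
Qed.

Lemma spec_norm_ub (R : realType) (p : nat) (A : 'M[R]_p) (v : 'I_p -> R) :
  \sum_i v i ^+ 2 <= 1 ->
  vnorm2 (fun i => \sum_j A i j * v j) <= spec_norm A.
Proof.
move=> v1; apply: ub_le_sup; last first.
  by exists v => //=; rewrite vnorm2_le// expr1n.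
(* A [sup] dominates its set only if that set is bounded above; the Frobenius norm is a bound, by
   Cauchy-Schwarz on each row. *)
have F0 : 0 <= \sum_i \sum_j A i j ^+ 2.
  by apply: sumr_ge0 => i _; apply: sumr_ge0 => j _; exact: sqr_ge0.
exists (Num.sqrt (\sum_i \sum_j A i j ^+ 2)) => _ [u /= u1 <-].
rewrite vnorm2_le ?sqrtr_ge0// sqr_sqrtr//; apply: ler_sum => i _.
rewrite (le_trans (cauchy_schwarz_sum _ _))// ler_piMr//.
  by apply: sumr_ge0 => j _; exact: sqr_ge0.
by move: u1; rewrite vnorm2_le// expr1n.
Qed.

Lemma spec_norm_ge0 (R : realType) (p : nat) (A : 'M[R]_p) : 0 <= spec_norm A.
Proof.
apply: le_trans (@spec_norm_ub R p A (fun=> 0) _); first exact: sqrtr_ge0.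
by rewrite big1// => i _; rewrite expr0n.
Qed.

(** By homogeneity, rescale [v] to unit length; the zero vector, which cannot be rescaled, is
    treated apart. *)
Lemma spec_norm_mulmx (R : realType) (p : nat) (A : 'M[R]_p) (v : 'I_p -> R) :
  \sum_i (\sum_j A i j * v j) ^+ 2 <= spec_norm A ^+ 2 * \sum_i v i ^+ 2.
Proof.
set s := \sum_i v i ^+ 2.
have s0 : 0 <= s by apply: sumr_ge0 => i _; exact: sqr_ge0.
have [s_eq0|s_neq0] := eqVneq s 0.
  have v0 i : v i = 0.
    apply/eqP; rewrite -sqrf_eq0; apply/eqP.
    by apply: (psumr_eq0P _ s_eq0) => // j _; exact: sqr_ge0.
  rewrite s_eq0 mulr0 big1// => i _; rewrite big1 ?expr0n// => j _.
  by rewrite v0 mulr0.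
have s_gt0 : 0 < s by rewrite lt_neqAle eq_sym s_neq0.
pose c := Num.sqrt s.
have c2 : c ^+ 2 = s by rewrite sqr_sqrtr.
have c_neq0 : c != 0 by rewrite sqrtr_eq0 -ltNge.
have := @spec_norm_ub R p A (fun i => c^-1 * v i) _.
rewrite vnorm2_le ?spec_norm_ge0//.
under eq_bigr do rewrite exprMn.
rewrite -mulr_sumr exprVn c2 mulVf// => /(_ (lexx _)).
under eq_bigr => i _.
  under eq_bigr do rewrite mulrCA.
  rewrite -mulr_sumr exprMn exprVn c2; over.
by rewrite -mulr_sumr mulrC ler_pdivrMr.
Qed.

Lemma sqr_quad_le (R : realType) (p : nat) (A : 'M[R]_p) (v : 'I_p -> R) :
  (\sum_i \sum_j v i * A i j * v j) ^+ 2 <=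
  spec_norm A ^+ 2 * (\sum_i v i ^+ 2) ^+ 2.
Proof.
have -> : \sum_i \sum_j v i * A i j * v j = \sum_i v i * \sum_j A i j * v j.
  apply: eq_bigr => i _; rewrite mulr_sumr; apply: eq_bigr => j _.
  by rewrite mulrA.
apply: le_trans (cauchy_schwarz_sum _ _) _.
rewrite [X in _ <= _ * X]expr2 mulrCA ler_wpM2l ?spec_norm_mulmx//.
by apply: sumr_ge0 => i _; exact: sqr_ge0.
Qed.

(** Each of the [p] columns is the image of a unit basis vector, so its squared length is at most
    [spec_norm A ^+ 2]. *)
Lemma spec_norm_frobenius (R : realType) (p : nat) (A : 'M[R]_p) :
  \sum_i \sum_j A i j ^+ 2 <= spec_norm A ^+ 2 * p%:R.
Proof.
rewrite exchange_big/= mulr_natr -[X in _ *+ X](card_ord p) -sumr_const.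
apply: ler_sum => j _.
have /= := @spec_norm_mulmx R p A (fun k => (j == k)%:R).
under eq_bigr do rewrite sum_delta.
move=> /le_trans; apply.
rewrite (bigD1 j)//= eqxx expr1n big1 ?addr0 ?mulr1// => k.
by rewrite eq_sym => /negbTE ->; rewrite expr0n.
Qed.

Lemma spec_norm_eq0 (R : realType) (p : nat) (A : 'M[R]_p) :
  spec_norm A = 0 -> A = 0.
Proof.
move=> A0; have := spec_norm_frobenius A; rewrite A0 expr0n mul0r => F0.
have c0 i : 0 <= \sum_j A i j ^+ 2 by apply: sumr_ge0 => j _; exact: sqr_ge0.
apply/matrixP => i j; rewrite mxE; apply/eqP; rewrite -sqrf_eq0.
rewrite eq_le sqr_ge0 andbT (le_trans _ F0)//.
rewrite (bigD1 i)//= (bigD1 j)//= -addrA lerDl addr_ge0//.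
  by apply: sumr_ge0 => k _; exact: sqr_ge0.
by apply: sumr_ge0 => k _; exact: c0.
Qed.

(** * Moments of a block-independent vector *)

(** Each factor is at most [c], the fourth root of the right-hand side; as [c] is at least 1, up to
    four factors give at most [c ^+ 4]. This dominates all monomials of degree at most 4 by fourth
    moments. *)
Lemma norm_prod_le_sum4 (R : realType) (p : nat) (v : 'I_p -> R) (s : seq 'I_p) :
  (size s <= 4)%N -> `|\prod_(t <- s) v t| <= 1 + \sum_t v t ^+ 4.
Proof.
move=> s4; set W := 1 + _.
have v0 t : 0 <= v t ^+ 4 by rewrite (exprM _ 2 2) sqr_ge0.
have W1 : 1 <= W by rewrite lerDl sumr_ge0.
pose c := Num.sqrt (Num.sqrt W).
have c4 : c ^+ 4 = W by rewrite (exprM _ 2 2) !sqr_sqrtr ?sqrtr_ge0// (le_trans _ W1).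
have c0 : 0 <= c by exact: sqrtr_ge0.
have c1 : 1 <= c by rewrite -(@ler_pXn2r _ 4) ?nnegrE// expr1n c4.
have vc t : `|v t| <= c.
  rewrite -(@ler_pXn2r _ 4) ?nnegrE// c4 -normrX ger0_norm// /W.
  by rewrite (bigD1 t)//= addrCA lerDl addr_ge0// sumr_ge0.
rewrite normr_prod -c4 (@le_trans _ _ (c ^+ size s))//; last exact: ler_weXn2l.
elim: s {s4} => [|t s IH]; first by rewrite big_nil expr0.
by rewrite big_cons exprS; apply: ler_pM => //; exact: prodr_ge0.
Qed.

Section block_moments.
Context (d : measure_display) (T : measurableType d) (R : realType)
  (P : probability T R) (p m : nat) (blk : 'I_p -> 'I_m)
  (x : 'I_p -> {RV P >-> R}).

(** A list, repetitions allowed, encodes a monomial; its part in one block is then a filter. *)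
Definition moment (s : seq 'I_p) : R := \int[P]_w (\prod_(t <- s) x t w).

Lemma measurable_monomial (s : seq 'I_p) :
  measurable_fun setT (fun w => \prod_(t <- s) x t w).
Proof. by apply: measurable_prod => t _. Qed.

Hypothesis x4 : forall i, P.-integrable setT (EFin \o (fun w => x i w ^+ 4)).

Lemma integrable_monomial (s : seq 'I_p) : (size s <= 4)%N ->
  P.-integrable setT (EFin \o (fun w => \prod_(t <- s) x t w)).
Proof.
move=> s4.
apply: (@le_integrable _ _ _ P setT _ _
  (EFin \o (fun w => 1 + \sum_t x t w ^+ 4))) => //.
- exact/measurable_EFinP/measurable_monomial.
- move=> w _ /=; rewrite lee_fin.
  by rewrite (le_trans (norm_prod_le_sum4 (fun t => x t w) s4))// ler_norm.
- rewrite (_ : EFin \o _ = cst 1%:E \+ (fun w => \sum_t (x t w ^+ 4)%:E)%E).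
    apply: integrableD => //; first exact: finite_measure_integrable_cst.
    by apply: integrable_sum => // t _; exact: x4.
  by apply/funext => w /=; rewrite EFinD sumEFin.
Qed.

Hypothesis x_mean : forall i, ('E_P[x i] = 0)%E.
Hypothesis x_cov : forall i j, ('E_P[x i \* x j] = ((i == j)%:R)%:E)%E.
Hypothesis x_indep : blocks_independent P blk (fun i => x i : T -> R).

Lemma moment0 : moment [::] = 1.
Proof.
rewrite /moment; under eq_Rintegral do rewrite big_nil.
by rewrite Rintegral_cst// mul1r -[RHS]/(fine 1%E) -(probability_setT P).
Qed.

Lemma moment1 i : moment [:: i] = 0.
Proof.
have := x_mean i; rewrite unlock => xi0.
rewrite /moment /Rintegral -[0]/(fine 0%E) -xi0.
by congr fine; apply: eq_integral => w _; rewrite big_seq1.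
Qed.

Lemma moment2 i j : moment [:: i; j] = (i == j)%:R.
Proof.
have := x_cov i j; rewrite unlock => xij.
rewrite /moment /Rintegral -[RHS]/(fine ((i == j)%:R)%:E) -xij.
by congr fine; apply: eq_integral => w _; rewrite big_cons big_seq1.
Qed.

(** Group the factors by block: each partial product is measurable for the sigma-algebra of its
    block, and these are independent. Blocks that [s] misses contribute the empty moment 1. *)
Lemma moment_blocks (s : seq 'I_p) : (size s <= 4)%N ->
  moment s = \prod_(a < m) moment [seq t <- s | blk t == a].
Proof.
move=> s4; rewrite /moment.
under eq_Rintegral do rewrite (partition_big blk xpredT)//=.
pose G (a : 'I_m) : set (set T) := [set E | exists i, blk i = a /\
  exists B : set R, measurable B /\ E = x i @^-1` B].
rewrite (@Rintegral_prod_indep _ _ _ P m G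
  (fun a w => \prod_(t <- s | blk t == a) x t w)).
- by apply: eq_bigr => a _; apply: eq_Rintegral => w _; rewrite big_filter.
- move=> a; apply: smallest_sub; first exact: sigma_algebra_measurable.
  move=> _ [i [_ [B [mB ->]]]]; rewrite -[_ @^-1` _]setTI.
  exact: measurable_funPT.
(* Independence is instantiated at the full set of blocks. *)
- move=> E GE; have := x_indep GE (finset predT).
  rewrite (_ : [set j | j \in _] = setT); last first.
    by apply/seteqP; split => // j _ /=; rewrite inE.
  by move=> ->; apply: eq_bigl => j; rewrite inE.
- move=> a; rewrite /sigma_measurable.
  under eq_fun do rewrite -big_filter.
  apply: (@measurable_prod _ (g_sigma_algebraType (G a))) => t.
  rewrite mem_filter => /andP[/eqP ta _] _ B mB.
  by rewrite setTI; apply: sub_sigma_algebra; exists t; split => //; exists B.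
- move=> a; under eq_fun do rewrite -big_filter.
  by apply: integrable_monomial; rewrite size_filter (leq_trans (count_size _ _)).
Qed.

(** An index alone in its block contributes its mean, which is zero. *)
Lemma moment_lone_block (s : seq 'I_p) t : (size s <= 4)%N ->
  [seq u <- s | blk u == blk t] = [:: t] -> moment s = 0.
Proof.
by move=> s4 st; rewrite moment_blocks// (bigD1 (blk t))//= st moment1 mul0r.
Qed.

Lemma moment_two_blocks (s : seq 'I_p) a b : (size s <= 4)%N -> a != b ->
  all (fun t => (blk t == a) || (blk t == b)) s ->
  moment s = moment [seq t <- s | blk t == a] * moment [seq t <- s | blk t == b].
Proof.
move=> s4 ab sab; rewrite moment_blocks// (bigD1 a)//= (bigD1 b)/=; last first.
  by rewrite eq_sym.
rewrite big1 ?mulr1// => c /andP[ca cb].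
rewrite (_ : [seq _ <- _ | _] = [::]) ?moment0//; apply/eqP.
rewrite -size_eq0 size_filter -leqn0 leqNgt -has_count; apply/hasPn => t ts.
by move: (allP sab _ ts) => /orP[] /eqP ->; rewrite eq_sym.
Qed.

Lemma moment4_within i j k l : blk i = blk j -> blk k = blk l -> blk i != blk k ->
  moment [:: i; j; k; l] = (i == j)%:R * (k == l)%:R.
Proof.
move=> ij kl ik; rewrite (@moment_two_blocks _ (blk i) (blk k))//=.
  by rewrite -ij -kl !eqxx (negbTE ik) eq_sym (negbTE ik) !moment2.
by rewrite -ij -kl !eqxx orbT.
Qed.

(** At most one of [k], [l] shares the block of [i] and [j], so the other is alone in its block. *)
Lemma moment4_mixed i j k l : blk i = blk j -> blk k != blk l ->
  moment [:: i; j; k; l] = 0.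
Proof.
move=> ij kl; have [ik|ik] := eqVneq (blk i) (blk k).
  apply: (@moment_lone_block _ l) => //=.
  by rewrite -ij ik (negbTE kl) eqxx.
apply: (@moment_lone_block _ k) => //=.
by rewrite -ij (negbTE ik) eqxx eq_sym (negbTE kl).
Qed.

Lemma moment_perm (s1 s2 : seq 'I_p) : perm_eq s1 s2 -> moment s1 = moment s2.
Proof. by move=> s12; apply: eq_Rintegral => w _; exact: perm_big. Qed.

(** Unless some index is alone in its block, the blocks of [k], [l] match those of [i], [j] in one
    of two mutually exclusive ways, and the moment is a product of two covariances. *)
Lemma moment4_cross i j k l : blk i != blk j -> blk k != blk l ->
  moment [:: i; j; k; l] =
  (i == k)%:R * (j == l)%:R + (i == l)%:R * (j == k)%:R.
Proof.
move=> ij kl.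
have neq u v : blk u != blk v -> (u == v) = false.
  by move=> uv; apply: contraNF uv => /eqP ->.
have [ik|ik] := eqVneq (blk i) (blk k).
  have il : blk i != blk l by rewrite ik.
  rewrite (neq _ _ il) mul0r addr0.
  have [jl|jl] := eqVneq (blk j) (blk l).
    rewrite (@moment_two_blocks _ (blk i) (blk j))//=.
      by rewrite -ik -jl !eqxx (negbTE ij) eq_sym (negbTE ij) !moment2.
    by rewrite -ik -jl !eqxx !orbT.
  rewrite (neq _ _ jl) mulr0; apply: (@moment_lone_block _ j) => //=.
  by rewrite -ik eqxx (negbTE ij) eq_sym (negbTE jl).
rewrite (neq _ _ ik) mul0r add0r.
have [il|il] := eqVneq (blk i) (blk l); last first.
  rewrite (neq _ _ il) mul0r; apply: (@moment_lone_block _ i) => //=.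
  by rewrite eqxx ![_ == blk i]eq_sym (negbTE ij) (negbTE ik) (negbTE il).
have [jk|jk] := eqVneq (blk j) (blk k).
  rewrite (@moment_two_blocks _ (blk i) (blk j))//=.
    by rewrite -il -jk !eqxx (negbTE ij) eq_sym (negbTE ij) !moment2.
  by rewrite -il -jk !eqxx !orbT.
rewrite (neq _ _ jk) mulr0; apply: (@moment_lone_block _ j) => //=.
by rewrite -il eqxx (negbTE ij) eq_sym (negbTE jk).
Qed.

End block_moments.

(** * Variance of the quadratic form *)

Lemma integrable_Rsum d (T : measurableType d) (R : realType)
    (P : probability T R) (I : finType) (F : I -> T -> R) :
  (forall i, P.-integrable setT (EFin \o F i)) ->
  P.-integrable setT (EFin \o (fun w => \sum_i F i w)).
Proof.
move=> iF; rewrite (_ : EFin \o _ = (fun w => \sum_i (F i w)%:E)%E).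
  by apply: integrable_sum => // i _; exact: iF.
by apply/funext => w /=; rewrite sumEFin.
Qed.

Lemma Rintegral_sum d (T : measurableType d) (R : realType)
    (P : probability T R) (I : finType) (F : I -> T -> R) :
  (forall i, P.-integrable setT (EFin \o F i)) ->
  \int[P]_w (\sum_i F i w) = \sum_i \int[P]_w F i w.
Proof.
move=> iF; apply: EFin_inj; rewrite EFin_Rintegral; last exact: integrable_Rsum.
under eq_integral do rewrite -sumEFin.
rewrite integral_sum// -sumEFin; apply: eq_bigr => i _.
by rewrite EFin_Rintegral.
Qed.

Lemma integrable_RZl d (T : measurableType d) (R : realType)
    (P : probability T R) (c : R) (f : T -> R) :
  P.-integrable setT (EFin \o f) ->
  P.-integrable setT (EFin \o (fun w => c * f w)).
Proof.
move=> intf; rewrite (_ : EFin \o _ = (fun w => c%:E * (f w)%:E)%E)//.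
exact: integrableZl.
Qed.

Section quadratic_form.
Context (d : measure_display) (T : measurableType d) (R : realType)
  (P : probability T R) (p m : nat) (blk : 'I_p -> 'I_m)
  (x : 'I_p -> {RV P >-> R}).
Hypothesis x4 : forall i, P.-integrable setT (EFin \o (fun w => x i w ^+ 4)).
Hypothesis x_cov : forall i j, ('E_P[x i \* x j] = ((i == j)%:R)%:E)%E.

Let Q (B : 'M[R]_p) : T -> R := quad_form B (fun i => x i : T -> R).

Lemma quad_form_pairE (B : 'M[R]_p) w :
  Q B w = \sum_(u : 'I_p * 'I_p) B u.1 u.2 * \prod_(t <- [:: u.1; u.2]) x t w.
Proof.
rewrite /Q /quad_form pair_big/=; apply: eq_bigr => -[i j] _ /=.
by rewrite big_cons big_seq1 mulrAC mulrC.
Qed.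

Lemma quad_form_sqrE (B : 'M[R]_p) w :
  Q B w ^+ 2 = \sum_(u : 'I_p * 'I_p) \sum_(v : 'I_p * 'I_p)
    B u.1 u.2 * B v.1 v.2 * \prod_(t <- [:: u.1; u.2; v.1; v.2]) x t w.
Proof.
rewrite quad_form_pairE sqr_sum; apply: eq_bigr => u _; apply: eq_bigr => v _.
by rewrite !big_cons !big_nil; ring.
Qed.

Lemma integrable_quad_form (B : 'M[R]_p) : P.-integrable setT (EFin \o Q B).
Proof.
rewrite (_ : Q B = (fun w => \sum_(u : 'I_p * 'I_p) B u.1 u.2 *
    \prod_(t <- [:: u.1; u.2]) x t w)); last exact/funext/quad_form_pairE.
by apply: integrable_Rsum => u; apply/integrable_RZl/integrable_monomial.
Qed.

Lemma integrable_quad_form_sqr (B : 'M[R]_p) :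
  P.-integrable setT (EFin \o (fun w => Q B w ^+ 2)).
Proof.
under eq_fun do rewrite quad_form_sqrE.
apply: integrable_Rsum => u; apply: integrable_Rsum => v.
exact/integrable_RZl/integrable_monomial.
Qed.

Lemma Rintegral_quad_form (B : 'M[R]_p) :
  \int[P]_w Q B w = \sum_(u : 'I_p * 'I_p) B u.1 u.2 * (u.1 == u.2)%:R.
Proof.
under eq_Rintegral do rewrite quad_form_pairE.
rewrite Rintegral_sum; last first.
  by move=> u; apply/integrable_RZl/integrable_monomial.
apply: eq_bigr => u _; rewrite RintegralZl//; last exact: integrable_monomial.
by rewrite -(moment2 x_cov).
Qed.

Lemma Rintegral_quad_form_sqr (B : 'M[R]_p) :
  \int[P]_w (Q B w ^+ 2) = \sum_(u : 'I_p * 'I_p) \sum_(v : 'I_p * 'I_p)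
    B u.1 u.2 * B v.1 v.2 * moment x [:: u.1; u.2; v.1; v.2].
Proof.
under eq_Rintegral do rewrite quad_form_sqrE.
have intM u v : P.-integrable setT (EFin \o (fun w => B u.1 u.2 * B v.1 v.2 *
    \prod_(t <- [:: u.1; u.2; v.1; v.2]) x t w)).
  exact/integrable_RZl/integrable_monomial.
rewrite Rintegral_sum; last by move=> u; exact: integrable_Rsum.
apply: eq_bigr => u _; rewrite Rintegral_sum//; apply: eq_bigr => v _.
by rewrite RintegralZl//; exact: integrable_monomial.
Qed.

(** The covariance of the two products [x u.1 * x u.2] and [x v.1 * x v.2], whose means are
    Kronecker deltas by isotropy. *)
Definition pair_cov (u v : 'I_p * 'I_p) : R :=
  moment x [:: u.1; u.2; v.1; v.2] - (u.1 == u.2)%:R * (v.1 == v.2)%:R.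

(** Serves twice: for the whole matrix, to expand the variance, and for each diagonal block, to
    reassemble the variance of that block's form. *)
Lemma sum_pair_cov (B : 'M[R]_p) :
  \sum_u \sum_v B u.1 u.2 * B v.1 v.2 * pair_cov u v =
  \int[P]_w (Q B w ^+ 2) - (\int[P]_w Q B w) ^+ 2.
Proof.
rewrite Rintegral_quad_form_sqr Rintegral_quad_form sqr_sum -sumrB.
apply: eq_bigr => u _; rewrite -sumrB; apply: eq_bigr => v _.
by rewrite /pair_cov; ring.
Qed.

Lemma variance_quad_form (B : 'M[R]_p) : (variance P (Q B) =
  (\sum_u \sum_v B u.1 u.2 * B v.1 v.2 * pair_cov u v)%:E)%E.
Proof.
have iQ := integrable_quad_form B; have iQ2 := integrable_quad_form_sqr B.
have EE (f : T -> R) : P.-integrable setT (EFin \o f) ->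
    ('E_P[f] = (\int[P]_w f w)%:E)%E.
  by move=> intf; rewrite EFin_Rintegral// unlock.
rewrite /variance covarianceE.
- by rewrite !EE// sum_pair_cov EFinB EFinM.
- exact/Lfun1_integrable.
- exact/Lfun1_integrable.
- exact/Lfun1_integrable.
Qed.

(** Zero padding to size [p] lets the results on [Q] apply to a single block. *)
Definition diag_block_mx (A : 'M[R]_p) (a : 'I_m) : 'M[R]_p :=
  \matrix_(i, j) if (blk i == a) && (blk j == a) then A i j else 0.

Definition off_block_mx (A : 'M[R]_p) : 'M[R]_p :=
  \matrix_(i, j) if blk i == blk j then 0 else A i j.

Hypothesis x_mean : forall i, ('E_P[x i] = 0)%E.
Hypothesis x_indep : blocks_independent P blk (fun i => x i : T -> R).

(** If [u] lies in a block, only that block's term remains, and the covariance vanishes unless [v]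
    lies there too. If [u] joins two blocks, the diagonal terms vanish, and so does the covariance
    unless [v] equals [u] or its transpose. *)
Lemma pair_cov_split (A : 'M[R]_p) (u v : 'I_p * 'I_p) :
  A u.1 u.2 * A v.1 v.2 * pair_cov u v =
  \sum_a diag_block_mx A a u.1 u.2 * diag_block_mx A a v.1 v.2 * pair_cov u v +
  off_block_mx A u.1 u.2 * off_block_mx A v.1 v.2 *
    ((u == v)%:R + ((u.2, u.1) == v)%:R).
Proof.
case: u v => [i j] [k l]; rewrite /pair_cov !mxE/= !xpair_eqE -!mulnb !natrM.
have neq u v : blk u != blk v -> (u == v) = false.
  by move=> uv; apply: contraNF uv => /eqP ->.
have [ij|ij] := eqVneq (blk i) (blk j).
  rewrite !mul0r addr0 (bigD1 (blk i))//= !mxE -ij eqxx/=.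
  rewrite big1 ?addr0; last first.
    by move=> a; rewrite !mxE eq_sym => /negbTE ->; rewrite !mul0r.
  have [ki|ki] := eqVneq (blk k) (blk i).
    have [li|li]//= := eqVneq (blk l) (blk i).
    have kl : blk k != blk l by rewrite ki eq_sym.
    by rewrite (moment4_mixed x4 x_mean x_indep)// (neq k l)// !mulr0 subrr mulr0 mul0r.
  rewrite /= mulr0 mul0r.
  have [kl|kl] := eqVneq (blk k) (blk l).
    rewrite (moment4_within x4 x_cov x_indep)// ?subrr ?mulr0//.
    by rewrite eq_sym.
  by rewrite (moment4_mixed x4 x_mean x_indep)// (neq k l)// mulr0 subrr mulr0.
rewrite big1 ?add0r; last first.
  move=> a _; rewrite !mxE; have [ia|//] := eqVneq (blk i) a; last first.
    by rewrite !mul0r.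
  by rewrite -ia eq_sym (negbTE ij) !mul0r.
rewrite (neq i j)// mul0r subr0.
have [kl|kl] := eqVneq (blk k) (blk l).
  (* Moments are symmetric; [moment4_mixed] wants the pair inside one block first. *)
  rewrite (@moment_perm _ _ _ _ _ x _ [:: k; l; i; j]); last first.
    by rewrite -[X in perm_eq X]/([:: i; j] ++ [:: k; l]) perm_catC.
  by rewrite (moment4_mixed x4 x_mean x_indep)// !mulr0 mul0r.
by rewrite (moment4_cross x4 x_mean x_cov x_indep)// [(j == k)%:R * _]mulrC.
Qed.

Lemma off_block_sum_le (A : 'M[R]_p) :
  \sum_u \sum_v off_block_mx A u.1 u.2 * off_block_mx A v.1 v.2 *
    ((u == v)%:R + ((u.2, u.1) == v)%:R) <= spec_norm A ^+ 2 * (2 * p)%:R.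
Proof.
set O := off_block_mx A.
have -> : \sum_u \sum_v O u.1 u.2 * O v.1 v.2 *
    ((u == v)%:R + ((u.2, u.1) == v)%:R) =
    \sum_i \sum_j O i j * (O i j + O j i).
  rewrite [RHS]pair_big/=; apply: eq_bigr => u _.
  under eq_bigr do rewrite mulrDr -!mulrA.
  by rewrite big_split/= -!mulr_sumr !sum_delta -mulrDr.
have swap : \sum_i \sum_j O j i ^+ 2 = \sum_i \sum_j O i j ^+ 2.
  by rewrite exchange_big.
have OA : \sum_i \sum_j O i j ^+ 2 <= \sum_i \sum_j A i j ^+ 2.
  apply: ler_sum => i _; apply: ler_sum => j _; rewrite mxE.
  by case: ifP => // _; rewrite expr0n sqr_ge0.
have := spec_norm_frobenius A.
(* From [O i j * O j i <= (O i j ^+ 2 + O j i ^+ 2) / 2]; after summation the weights 3/2 and 1/2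
   add up to twice the squared Frobenius norm. *)
have : \sum_i \sum_j O i j * (O i j + O j i) <=
    \sum_i \sum_j (3 / 2 * O i j ^+ 2 + 1 / 2 * O j i ^+ 2).
  apply: ler_sum => i _; apply: ler_sum => j _.
  by have := sqr_ge0 (O i j - O j i); nra.
under [X in _ <= X]eq_bigr do rewrite big_split/= -!mulr_sumr.
rewrite big_split/= -!mulr_sumr swap natrM; lra.
Qed.

(** One factor [n] comes from Cauchy-Schwarz, bounding the fourth power of the block's norm by
    [n * S], the other from the [n] fourth moments in [S]. *)
Lemma block_quad_form_le (A : 'M[R]_p) (k : R) (a : 'I_m) :
  (forall i, \int[P]_w (x i w ^+ 4) <= k) ->
  \int[P]_w (Q (diag_block_mx A a) w ^+ 2) <=
  spec_norm A ^+ 2 * (k * (#|[pred i | blk i == a]| ^ 2)%:R).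
Proof.
move=> xk; set n := #|_|.
pose S w := \sum_i (blk i == a)%:R * x i w ^+ 4.
have iS : P.-integrable setT (EFin \o S).
  by apply: integrable_Rsum => i; exact: integrable_RZl.
have Sk : \int[P]_w S w <= n%:R * k.
  rewrite Rintegral_sum; last by move=> i; exact: integrable_RZl.
  rewrite /n -sum1_card natr_sum mulr_suml [X in _ <= X]big_mkcond/=.
  apply: ler_sum => i _; rewrite RintegralZl// inE.
  by case: ifP => _; rewrite ?mul1r ?mul0r.
apply: (@le_trans _ _ (\int[P]_w (spec_norm A ^+ 2 * n%:R * S w))).
  apply: le_Rintegral => //; first exact: integrable_quad_form_sqr.
    exact: integrable_RZl.
  (* Masking the vector instead of the matrix brings in the norm of [A] itself, so norms of
     submatrices need not be compared. *)
  move=> w _; pose v i := (blk i == a)%:R * x i w.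
  have -> : Q (diag_block_mx A a) w = \sum_i \sum_j v i * A i j * v j.
    apply: eq_bigr => i _; apply: eq_bigr => j _; rewrite mxE /v.
    by case: (blk i == a); case: (blk j == a) => /=; ring.
  apply: le_trans (sqr_quad_le _ _) _; rewrite -mulrA ler_wpM2l ?sqr_ge0//.
  have -> : \sum_i v i ^+ 2 = \sum_(i | blk i == a) x i w ^+ 2.
    rewrite [RHS]big_mkcond/=; apply: eq_bigr => i _; rewrite /v.
    by case: ifP => _; rewrite ?mul1r ?mul0r ?expr0n.
  have -> : S w = \sum_(i | blk i == a) (x i w ^+ 2) ^+ 2.
    rewrite [RHS]big_mkcond/=; apply: eq_bigr => i _.
    by case: ifP => _; rewrite ?mul1r ?mul0r -?exprM.
  exact: sqr_sum_le_card.
rewrite RintegralZl// -mulrA ler_wpM2l ?sqr_ge0//.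
have := ler_wpM2l (ler0n R n) Sk; rewrite natrX; lra.
Qed.

Lemma variance_quad_form_le (A : 'M[R]_p) (k : R) :
  (forall i, \int[P]_w (x i w ^+ 4) <= k) ->
  (variance P (Q A) <= (spec_norm A ^+ 2 *
    (k * \sum_(j < m) (#|[pred i | blk i == j]| ^ 2)%:R + (2 * p)%:R))%:E)%E.
Proof.
move=> xk; rewrite variance_quad_form lee_fin.
under eq_bigr do under eq_bigr do rewrite pair_cov_split.
under eq_bigr do rewrite big_split/=.
rewrite big_split/= mulrDr lerD ?off_block_sum_le//.
under eq_bigr do rewrite exchange_big/=.
rewrite exchange_big/= !mulr_sumr; apply: ler_sum => a _.
(* The variance of a block's form is at most its second moment. *)
rewrite sum_pair_cov; apply: le_trans (block_quad_form_le _ _ xk).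
by rewrite gerBl sqr_ge0.
Qed.

End quadratic_form.

Theorem theorem1p6 (d : measure_display) (T : measurableType d)
  (R : realType) (P : probability T R) (p m : nat)
  (blk : 'I_p -> 'I_m) (x : 'I_p -> {RV P >-> R}) (A : 'M[R]_p) :
  block_independent_model P blk (fun i => x i : T -> R) ->
  let K := (\big[maxe/0%E]_(i < p) 'E_P[(x i : T -> R) ^+ 4])%E in
  let dj := fun j : 'I_m => #|[pred i | blk i == j]| in
  (variance P (quad_form A (fun i => x i : T -> R)) <=
    (spec_norm A ^+ 2)%:E * (K * (\sum_(j < m) (dj j ^ 2)%:R)%:E + (2 * p)%:R%:E))%E.
Proof.
move=> [x_mean x_cov x_indep]; cbv zeta.
set K := \big[_/_]_(i < p) _; pose dj (j : 'I_m) := #|[pred i | blk i == j]|.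
have K0 : (0 <= K)%E by exact: bigmax_ge_id.
have x40 i w : 0 <= x i w ^+ 4 by rewrite (exprM _ 2 2) sqr_ge0.
have EK i : (\int[P]_w (x i w ^+ 4)%:E <= K)%E.
  have := le_bigmax 0%E (fun i => 'E_P[(x i : T -> R) ^+ 4]%E) i.
  by rewrite -/K unlock.
(* For zero norm the bound is 0 even if [K] is infinite, since [0 * +oo = 0]; but then [A = 0] and
   the form vanishes. *)
have [A0|A_neq0] := eqVneq (spec_norm A) 0.
  rewrite A0 expr0n mul0e (_ : quad_form _ _ = cst 0) ?variance_cst//.
  apply/funext => w; rewrite /quad_form big1// => i _; rewrite big1// => j _.
  by rewrite (spec_norm_eq0 A0) mxE mulr0 mul0r.
(* A finite [K] makes all fourth powers integrable; [-oo] is excluded by [K0]. *)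
move: K0 EK; case: K => [k k0 EK|_ EK|//].
  have x4 i : P.-integrable setT (EFin \o (fun w => x i w ^+ 4)).
    apply/integrableP; split; first exact/measurable_EFinP/measurable_funX.
    under eq_integral do rewrite /= ger0_norm//.
    by rewrite (le_lt_trans (EK i))// ltry.
  apply: (variance_quad_form_le x4 x_cov x_mean x_indep) => i.
  by rewrite -lee_fin EFin_Rintegral.
have [p0|p_gt0] := posnP p.
  rewrite (_ : quad_form _ _ = cst 0) ?variance_cst; last first.
    by apply/funext => w; rewrite /quad_form big1// => i _; have := ltn_ord i; lia.
  by rewrite mule_ge0 ?lee_fin ?sqr_ge0// adde_ge0// mule_ge0// lee_fin sumr_ge0.
(* Some block is nonempty, so multiplying [+oo] by this sum gives [+oo] rather than 0, and the bound
   is infinite. *)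
have dj_gt0 : 0 < \sum_(j < m) (dj j ^ 2)%:R :> R.
  rewrite (bigD1 (blk (Ordinal p_gt0)))//= ltr_wpDr ?sumr_ge0//.
  by rewrite ltr0n expn_gt0 orbF; apply/card_gt0P; exists (Ordinal p_gt0); rewrite inE.
rewrite gt0_mulye ?lte_fin// addye// gt0_muley ?leey// lte_fin.
by rewrite exprn_even_gt0//= A_neq0.
Qed.
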